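(* Let $k,n \geq 1$ be integers and let $H_{k,n}$ be the (simple, unweighted) hexagonal grid graph. Then $$\det A(H_{k,n}) = (-1)^{kn+n+k}\left[\binom{n+k}{n}\right]^2 .$$
   Context: $A(G)$ denotes the usual adjacency matrix of a finite simple graph $G$ (entry $1$ for adjacent pairs of vertices, $0$ otherwise, zero diagonal). Hexagonal grid: for integers $p,q\ge 1$ the simple graph $H_{p,q}$ is defined as follows. Take the disjoint union $G$ of $q+1$ simple paths: for each $i\in\{1,\dots,q\}$ the path $P^i = v^i_1 v^i_2 \dots v^i_{2p+1} v^i_{2p+2}$ on $2p+2$ vertices, and the path $P^{q+1} = v^{q+1}_2 v^{q+1}_3\dots v^{q+1}_{2p+1}$ on $2p$ vertices. Then $V(H_{p,q})=V(G)$, and the edges of $H_{p,q}$ are exactly: all edges of $G$; the edges $v^{i+1}_2 v^i_1$ for $i\in\{1,\dots,q\}$; and the edges $v^{i+1}_{2j+1}v^i_{2j+2}$ for $j\in\{1,\dots,p\}$, $i\in\{1,\dots,q\}$. Thus $H_{k,n}$ is obtained with $p=k$, $q=n$. *)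

(* Defs.v *)
From mathcomp Require Import all_boot all_order all_algebra.

Set Implicit Arguments.
Unset Strict Implicit.
Unset Printing Implicit Defensive.

Import GRing.Theory.
Local Open Scope ring_scope.

Record simple_graph := SimpleGraph {
  vertex : finType;
  adj : rel vertex;
  adj_sym : symmetric adj;
  adj_irr : irreflexive adj
}.

(* Rows and columns follow the canonical enumeration of the vertices; the
   determinant does not depend on this choice. *)
Definition adjacency_matrix (G : simple_graph) : 'M[int]_#|vertex G| :=
  \matrix_(a, b) (adj (enum_val a) (enum_val b))%:R.

Section HexagonalGrid.
Local Open Scope nat_scope.
Variables p q : nat.

(* Indices are 1-based: the pair (i, j) stands for v^i_j.  The paths P^1 .. P^q
   have j ranging over 1 .. 2p+2, and the last one, P^{q+1}, over 2 .. 2p+1. *)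
Definition hex_vertex (i j : nat) : bool :=
  (1 <= i <= q) && (1 <= j <= 2 * p + 2)
  || (i == q + 1) && (2 <= j <= 2 * p + 1).

(* The ordinals only provide finite ranges large enough to contain all indices
   i <= q+1 and j <= 2p+2. *)
Definition hex_vertices : finType :=
  {v : 'I_(q + 2) * 'I_(2 * p + 3) | hex_vertex v.1 v.2}.

(* One orientation of each edge, from v^i_j to v^i'_j': consecutive vertices of
   a path, then v^i_1 to v^{i+1}_2, then v^i_{2t+2} to v^{i+1}_{2t+1} with
   1 <= t <= p. *)
Definition hex_arc (i j i' j' : nat) : bool :=
  [|| (i' == i) && (j' == j + 1),
      [&& 1 <= i <= q, i' == i + 1, j == 1 & j' == 2]
    | [&& 1 <= i <= q, i' == i + 1
        & has (fun t => (j == 2 * t + 2) && (j' == 2 * t + 1)) (iota 1 p)]].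

Definition hex_adj (u v : hex_vertices) : bool :=
  let: (i, j) := val u in let: (i', j') := val v in
  hex_arc i j i' j' || hex_arc i' j' i j.

Lemma hex_adj_sym : symmetric hex_adj.
Proof.
by move=> u v; rewrite /hex_adj; case: (val u) (val v) => [i j] [i' j']; rewrite orbC.
Qed.

Lemma hex_adj_irr : irreflexive hex_adj.
Proof.
move=> u; rewrite /hex_adj; case: (val u) => i j.
by rewrite orbb /hex_arc !addn1 !(ltn_eqF (ltnSn _)) andbF /= !andbF.
Qed.

Definition hex_grid : simple_graph := SimpleGraph hex_adj_sym hex_adj_irr.

End HexagonalGrid.

(* Main.v *)
(* The grid is bipartite by the parity of the second index, so that
   [\det A = (-1)^N (\det B)^2], where [B] is the square matrix of size
   [N = kn + n + k] recording the adjacency of odd and even vertices.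
   Read a number [x <= N] as a point [(x / (k+1), x mod (k+1))] of the
   [(n+1) x (k+1)] rectangle.  The odd vertices can be numbered from 1 to [N] and
   the even ones from 0 to [N - 1] in such a way that the odd vertex [x] is
   adjacent to the even vertex [y] exactly when the point [y] is [x] or one of its
   predecessors in the two coordinate directions.  Allowing [0 <= x, y <= N]
   yields a unitriangular matrix [L], of which [B] is the minor without row 0 and
   column [N].  By Cramer's rule this minor is, up to sign, the last coordinate of
   the solution of [L f = e_0]; as [L f = e_0] is Pascal's recurrence with signs,
   that coordinate is, up to sign, [binomial(n+k, n)]. *)
Require Import Defs.
From mathcomp Require Import all_boot all_order all_algebra.
From mathcomp Require Import perm zify ring.

Import GRing.Theory.
Local Open Scope ring_scope.

(** * Determinants: reindexing, antidiagonal blocks, cofactors *)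

Lemma inj_surj_bij (A B : finType) (f : A -> B) :
  injective f -> (forall b, exists a, f a = b) -> bijective f.
Proof.
move=> f_inj f_surj; have [g gK] := fin_all_exists f_surj.
by exists g => // a; apply: f_inj.
Qed.

(** Rows and columns undergo the same permutation, so its sign occurs twice and cancels. *)
Lemma det_reindex (R : comNzRingType) (T : finType) (m : nat)
    (phi : 'I_m -> T) (F : T -> T -> R) :
  bijective phi ->
  \det (\matrix_(a < #|T|, b < #|T|) F (enum_val a) (enum_val b)) =
  \det (\matrix_(i, j) F (phi i) (phi j)).
Proof.
move=> phi_bij; have eq_m : m = #|T|.
  by rewrite -(bij_eq_card phi_bij) card_ord.
subst m; have rank_inj : injective (fun i => enum_rank (phi i)).
  by move=> i j /enum_rank_inj/(bij_inj phi_bij).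
set A := (X in \det X = _).
suff -> : \matrix_(i, j) F (phi i) (phi j) =
    row_perm (perm rank_inj) (col_perm (perm rank_inj) A).
  by rewrite row_permE col_permE !det_mulmx !det_perm odd_permV mulrCA -expr2
    sqrr_sign mulr1.
by apply/matrixP => i j; rewrite !mxE !permE !enum_rankK.
Qed.

Lemma det_block_antidiag (R : comNzRingType) (N : nat) (B C : 'M[R]_N) :
  \det (block_mx 0 B C 0) = (-1) ^+ N * (\det B * \det C).
Proof.
pose U : 'M[R]_(N + N) := block_mx 1%:M 1%:M 0 1%:M.
pose V : 'M[R]_(N + N) := block_mx 1%:M 0 (- 1%:M) 1%:M.
have detU : \det U = 1 by rewrite det_ublock !det1 mulr1.
have detV : \det V = 1 by rewrite det_lblock !det1 mulr1.
(* [U V U] is [[0, 1], [-1, 0]]: it swaps the two blocks of columns. *)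
have -> : \det (block_mx 0 B C 0) = \det (block_mx 0 B C 0 *m (U *m V *m U)).
  by rewrite !det_mulmx detU detV !mulr1.
rewrite !mulmx_block !(mul0mx, mulmx0, mul1mx, mulmx1, mulmxN, mulNmx).
rewrite !(addr0, add0r, addrN, addNr, mulmx0, mulmx1, mulmxN) det_ublock.
by rewrite -scaleN1r detZ mulrA.
Qed.

(** Applying the adjugate to [L *m f = delta_mx i 0] isolates its entry [(j, i)], which is the minor
    up to a sign; squaring removes that sign. *)
Lemma sqr_cofactor_Cramer (R : comNzRingType) (N : nat) (L : 'M[R]_N)
    (i j : 'I_N) (f : 'cV[R]_N) :
  L *m f = delta_mx i 0 ->
  \det (row' i (col' j L)) ^+ 2 = (\det L * f j 0) ^+ 2.
Proof.
move=> Lf; have /matrixP/(_ j 0) : \adj L *m (L *m f) = \det L *: f.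
  by rewrite mulmxA mul_adj_mx mul_scalar_mx.
rewrite Lf -colE !mxE /cofactor => <-.
by rewrite exprMn sqrr_sign mul1r.
Qed.

(** * The unitriangular matrix of the signed Pascal recurrence *)

Section PascalMatrix.
Variable P : nat.
Hypothesis P_gt0 : (0 < P)%N.

(** In base [P], subtracting [P] or 1 steps back in the first or second coordinate. The divisibility
    test keeps the start of a row from wrapping to the end of the previous row. *)
Definition grid_step (x y : nat) : bool :=
  [|| y == x, (y + P == x)%N | (y.+1 == x) && ~~ (P %| x)%N].

Definition step_mx (N : nat) : 'M[int]_N.+1 := \matrix_(x, y) (grid_step x y)%:R.

(** Lattice paths from the origin to the point [x], counted with one sign per step. *)
Definition signed_binomial (x : nat) : int :=
  (-1) ^+ (x %/ P + x %% P) * ('C(x %/ P + x %% P, x %/ P))%:R.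

Lemma det_step_mx (N : nat) : \det (step_mx N) = 1.
Proof.
rewrite det_trig.
  by apply: big1 => i _; rewrite mxE /grid_step eqxx.
apply/is_trig_mxP => i j lt_ij; rewrite mxE.
suff -> : grid_step i j = false by [].
by rewrite /grid_step; lia.
Qed.

Lemma eq_coords (i a j b : nat) : (a < P)%N -> (b < P)%N ->
  (i * P + a == j * P + b)%N = (i == j) && (a == b).
Proof.
move=> lt_aP lt_bP; apply/eqP/andP => [eq_xy|[/eqP-> /eqP->]//].
have /(congr1 (modn^~ P)) := eq_xy; have /(congr1 (divn^~ P)) := eq_xy.
rewrite !divnMDl // !divn_small // !addn0 !modnMDl !modn_small // => -> ->.
by rewrite !eqxx.
Qed.

Lemma grid_step_coords (i a j b : nat) : (a < P)%N -> (b < P)%N ->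
  grid_step (i * P + a) (j * P + b) =
  [|| (j == i) && (b == a), (j.+1 == i) && (b == a) | (j == i) && (b.+1 == a)].
Proof.
move=> lt_aP lt_bP; rewrite /grid_step eq_coords // addnAC -mulSnr eq_coords //.
congr [|| _, _ | _]; rewrite /dvdn modnMDl modn_small //.
case: a lt_aP => [|a] lt_aP; first by rewrite !andbF.
by rewrite andbT addnS !eqSS eq_coords // ltnW.
Qed.

Lemma signed_binomial_coords (i a : nat) : (a < P)%N ->
  signed_binomial (i * P + a) = (-1) ^+ (i + a) * ('C(i + a, i))%:R.
Proof.
move=> lt_aP; rewrite /signed_binomial divnMDl // divn_small // addn0.
by rewrite modnMDl modn_small.
Qed.

(** Pascal's rule: the alternating sign makes a value cancel against its predecessors. The guards
    drop predecessors that would leave the grid; the origin has none, which leaves the 1. *)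
Lemma signed_binomial_rec (x : nat) :
  signed_binomial x + (if (P <= x)%N then signed_binomial (x - P) else 0) +
  (if ~~ (P %| x)%N then signed_binomial x.-1 else 0) = (x == 0%N)%:R.
Proof.
rewrite (divn_eq x P); move: (x %/ P)%N (x %% P)%N (ltn_pmod x P_gt0) => i a lt_aP.
rewrite signed_binomial_coords // /dvdn modnMDl modn_small //.
case: i => [|i].
  rewrite mul0n !add0n leqNgt lt_aP bin0 /= addr0.
  case: a lt_aP => [|a] lt_aP; first by rewrite addr0.
  rewrite -[a in signed_binomial a]add0n -[0%N](mul0n P) /=.
  by rewrite signed_binomial_coords ?(ltnW lt_aP) // bin0 !add0n exprS; ring.
rewrite [(P <= _)%N](_ : _ = true); last by rewrite mulSn -addnA leq_addr.
rewrite [(_ + _ - P)%N](_ : _ = i * P + a)%N; last by rewrite mulSn; lia.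
rewrite signed_binomial_coords // [(_ + _)%N == 0%N](_ : _ = false);
  last by rewrite mulSn; lia.
case: a lt_aP => [|a] lt_aP; first by rewrite !addn0 !binn exprS /=; ring.
rewrite ![(_ + a.+1)%N]addnS addSn /= signed_binomial_coords ?(ltnW lt_aP) //.
rewrite addSn binS.
by rewrite natrD !exprS /=; ring.
Qed.

Lemma step_mx_signed_binomial (N : nat) :
  step_mx N *m (\col_x signed_binomial x) = delta_mx 0 0.
Proof.
apply/matrixP => x z; rewrite ord1 !mxE eqxx andbT.
rewrite -[RHS](signed_binomial_rec x).
under eq_bigr => y _ do rewrite !mxE.
have sum_eq (t : nat) : (t <= x)%N ->
    \sum_(y < N.+1) (y == t :> nat)%:R * signed_binomial y = signed_binomial t.
  move=> le_tx; have lt_tN : (t < N.+1)%N by apply: leq_ltn_trans (ltn_ord x).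
  rewrite (bigD1 (Ordinal lt_tN)) //= eqxx mul1r big1 ?addr0 // => y neq_y.
  by rewrite -[_ == t]/(y == Ordinal lt_tN) (negPf neq_y) mul0r.
(* The three disjuncts of [grid_step] exclude one another, so its indicator is the sum of theirs. *)
transitivity (\sum_(y < N.+1) ((y == x :> nat)%:R * signed_binomial y +
    (y + P == x)%N%:R * signed_binomial y +
    ((y.+1 == x) && ~~ (P %| x)%N)%:R * signed_binomial y)).
  apply: eq_bigr => y _; rewrite -!mulrDl; congr (_ * _).
  rewrite /grid_step; case: eqP => [y_x|_] /=.
    have yP_x : (y + P == x)%N = false by lia.
    have y1_x : (y.+1 == x) = false by lia.
    by rewrite yP_x y1_x /= !addr0.
  rewrite add0r; case: eqP => [yP_x|_] /=; last by rewrite add0r.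
  (* The two predecessors could coincide only for [P = 1], where [P] divides every [x]. *)
  have y1_x : (y.+1 == x) && ~~ (P %| x)%N = false.
    apply/negP => /andP[/eqP y1_x /negP]; apply.
    by have -> : P = 1%N; [lia | rewrite dvd1n].
  by rewrite y1_x addr0.
rewrite !big_split /= sum_eq //; congr (_ + _ + _).
  case: ifP => [le_Px|gt_Px].
    rewrite -(sum_eq (x - P)%N) ?leq_subr //; apply: eq_bigr => y _.
    by congr (_%:R * _); lia.
  by rewrite big1 // => y _; rewrite (_ : _ == _ = false) ?mul0r //; lia.
case: ifP => [ndvd_Px|_]; last by rewrite big1 // => y _; rewrite andbF mul0r.
have x_gt0 : (0 < x)%N by case: (nat_of_ord x) ndvd_Px; rewrite ?dvdn0.
rewrite -(sum_eq x.-1) ?leq_pred //; apply: eq_bigr => y _.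
by congr (_%:R * _); lia.
Qed.

End PascalMatrix.

Lemma sqr_det_step_minor (k n N : nat) : N = (k * n + n + k)%N ->
  \det (\matrix_(a < N, b < N) (grid_step k.+1 a.+1 b)%:R : 'M[int]_N) ^+ 2 =
  'C(n + k, n)%:R ^+ 2.
Proof.
move=> defN; set B := (X in \det X).
have -> : B = row' ord0 (col' ord_max (step_mx k.+1 N)).
  by apply/matrixP => a b; rewrite !mxE lift0 lift_max.
rewrite (sqr_cofactor_Cramer _ _ _ _ _ _ (step_mx_signed_binomial _ (ltn0Sn k) N)).
rewrite det_step_mx // mul1r mxE /=.
(* The last index is the corner [(n, k)] of the rectangle. *)
have -> : N = (n * k.+1 + k)%N by rewrite defN; lia.
by rewrite signed_binomial_coords // exprMn sqrr_sign mul1r.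
Qed.

(** * Rectangle coordinates for the vertices of the hexagonal grid *)

Section HexagonalCoordinates.
Local Open Scope nat_scope.
Variables k n : nat.

(* The edges added between two consecutive paths make (i, a) adjacent to
   (i - 1, a); for a = 0 this forces the shift of i by one. *)
Definition odd_position (i a : nat) : nat * nat :=
  if a == 0%N then (i, 1%N) else (i.+1, a.*2.+1).

Lemma odd_position_inj (i a j b : nat) :
  odd_position i a = odd_position j b -> i = j /\ a = b.
Proof. by case: a b => [|a] [|b] [] /=; lia. Qed.

Definition even_position (j b : nat) : nat * nat := (j.+1, b.*2.+2).

(** Trading the search over [t] for parity and bounds turns adjacency into linear arithmetic. *)
Lemma hex_arcE (i j i' j' : nat) :
  hex_arc k n i j i' j' =
  [|| (i' == i) && (j' == j.+1),
      [&& 0 < i <= n, i' == i.+1, j == 1 & j' == 2]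
    | [&& 0 < i <= n, i' == i.+1, j == j'.+1, odd j' & 2 < j' <= k.*2.+1]]%N.
Proof.
rewrite /hex_arc !addn1; congr [|| _, _ | [&& _, _ & _]].
apply/hasP/and3P => [[t]|[/eqP j_eq odd_j' j'_range]].
  by rewrite mem_iota => t_range /andP[/eqP-> /eqP->]; split; lia.
by exists j'./2; rewrite ?mem_iota; lia.
Qed.

(** Every kind of edge changes the second index by exactly one, whence the bipartition. *)
Lemma hex_arc_parity (i j i' j' : nat) :
  hex_arc k n i j i' j' -> odd j' = ~~ odd j.
Proof. by rewrite hex_arcE; lia. Qed.

(** For [a > 0], path edges lead to [(i, a)] and [(i, a - 1)], and the edge between paths to
    [(i - 1, a)]. For [a = 0] the roles change: the path edge leads to [(i - 1, 0)], the other one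
    to [(i, 0)]. *)
Lemma hex_arc_odd_even (i a j b : nat) :
    (i <= n)%N -> (a <= k)%N -> (j <= n)%N -> (b <= k)%N -> (0 < i + a)%N ->
  let u := odd_position i a in let v := even_position j b in
  hex_arc k n u.1 u.2 v.1 v.2 || hex_arc k n v.1 v.2 u.1 u.2 =
  [|| (j == i) && (b == a), (j.+1 == i) && (b == a) | (j == i) && (b.+1 == a)].
Proof.
move=> le_in le_ak le_jn le_bk ia_gt0 u v; rewrite !hex_arcE {}/u {}/v /odd_position.
by case: a le_ak ia_gt0 => [|a] le_ak ia_gt0 /=; lia.
Qed.

Definition odd_position_of (x : nat) := odd_position (x %/ k.+1) (x %% k.+1).
Definition even_position_of (y : nat) := even_position (y %/ k.+1) (y %% k.+1).

Lemma odd_odd_position (x : nat) : odd (odd_position_of x).2.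
Proof. by rewrite /odd_position_of /odd_position; case: ifP => //= _; lia. Qed.

Lemma odd_even_position (y : nat) : ~~ odd (even_position_of y).2.
Proof. by rewrite /=; lia. Qed.

Lemma coords_bound (x : nat) : (x <= k * n + n + k)%N ->
  (x %/ k.+1 <= n)%N /\ (x %% k.+1 <= k)%N.
Proof.
move=> le_xN; split; last by rewrite -ltnS ltn_pmod.
by rewrite -ltnS ltn_divLR //; lia.
Qed.

Lemma coords_gt0 (x : nat) : (0 < x)%N -> (0 < x %/ k.+1 + x %% k.+1)%N.
Proof.
rewrite !lt0n; apply: contra; rewrite addn_eq0 => /andP[/eqP i0 /eqP a0].
by rewrite (divn_eq x k.+1) i0 a0.
Qed.

Lemma hex_arc_grid_step (x y : nat) :
    (0 < x <= k * n + n + k)%N -> (y <= k * n + n + k)%N ->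
  let u := odd_position_of x in let v := even_position_of y in
  hex_arc k n u.1 u.2 v.1 v.2 || hex_arc k n v.1 v.2 u.1 u.2 =
  grid_step k.+1 x y.
Proof.
move=> /andP[x_gt0 /coords_bound[le_in le_ak]] /coords_bound[le_jn le_bk].
rewrite /= hex_arc_odd_even ?coords_gt0 //.
by rewrite [in RHS](divn_eq x k.+1) [in RHS](divn_eq y k.+1) grid_step_coords.
Qed.

Let N := k * n + n + k.

(** Listing the odd class before the even one will put the adjacency matrix in antidiagonal block
    form. *)
Definition position (s : 'I_N + 'I_N) : nat * nat :=
  match s with inl x => odd_position_of x.+1 | inr y => even_position_of y end.

Lemma position_vertex (s : 'I_N + 'I_N) :
  hex_vertex k n (position s).1 (position s).2.
Proof.
case: s => [x|y] /=; rewrite /hex_vertex.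
  have [le_in le_ak] := coords_bound _ (ltn_ord x).
  (* This excludes the origin, whose odd position [(0, 1)] lies on no path. *)
  have := coords_gt0 x.+1 (ltn0Sn x).
  rewrite /odd_position_of /odd_position; move: (_ %/ _) (_ %% _) le_in le_ak.
  by move=> i [|a] le_in le_ak /=; lia.
have [le_jn le_bk] := coords_bound _ (ltnW (ltn_ord y)).
(* This excludes the corner [(n, k)], whose even position would be the missing last vertex of path
   [n + 1]. *)
have : y != n * k.+1 + k :> nat by have := ltn_ord y; rewrite {2}/N; lia.
rewrite {1}(divn_eq y k.+1) eq_coords // /even_position_of /even_position.
by move: (_ %/ _) (_ %% _) le_jn le_bk => j b /=; lia.
Qed.

Lemma position_inj : injective position.
Proof.
have coords_inj x y : x %/ k.+1 = y %/ k.+1 -> x %% k.+1 = y %% k.+1 -> x = y.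
  by move=> eq_q eq_r; rewrite (divn_eq x k.+1) eq_q eq_r -divn_eq.
move=> [x|x] [y|y] /= eq_pos.
- have [eq_q eq_r] := odd_position_inj _ _ _ _ eq_pos.
  by congr inl; apply/val_inj/succn_inj/coords_inj.
- by have := odd_even_position y; rewrite -eq_pos odd_odd_position.
- by have := odd_even_position x; rewrite eq_pos odd_odd_position.
- by move: eq_pos => [eq_q eq_r]; congr inr; apply/val_inj/coords_inj; lia.
Qed.

Lemma position_surj (i j : nat) :
  hex_vertex k n i j -> exists s, position s = (i, j).
Proof.
rewrite /hex_vertex => ij_vertex; have [j_odd|j_even] := boolP (odd j).
  (* [c] inverts [odd_position]; the predecessor taken below undoes the numbering from 1. *)
  pose c := if j == 1 then (i, 0) else (i.-1, j./2).
  have [c1 c2 c_gt0] : [/\ c.1 <= n, c.2 <= k & 0 < c.1 + c.2].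
    by rewrite /c; case: (j =P 1) => /= j1; split; lia.
  have lt_xN : (c.1 * k.+1 + c.2).-1 < N.
    by have := leq_mul c1 (leqnn k.+1); rewrite /N; nia.
  exists (inl (Ordinal lt_xN)) => /=; rewrite prednK; last by nia.
  rewrite /odd_position_of divnMDl // divn_small // addn0 modnMDl modn_small //.
  rewrite /odd_position /c; case: (j =P 1) => [->//|j_neq1] /=.
  by rewrite ifN; [congr (_, _); lia | lia].
have c1 : i.-1 <= n by lia.
have c2 : j./2.-1 <= k by lia.
have lt_yN : i.-1 * k.+1 + j./2.-1 < N.
  (* The bound is strict because only the corner [(n, k)] has index [N], and it is not a vertex
     here. *)
  have := leq_mul c1 (leqnn k.+1); have := eq_coords k.+1 isT i.-1 j./2.-1 n k.
  by rewrite /N !ltnS c2 leqnn => /(_ isT isT); lia.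
exists (inr (Ordinal lt_yN)) => /=; rewrite /even_position_of.
rewrite divnMDl // divn_small // addn0 modnMDl modn_small //.
by rewrite /even_position; congr (_, _); lia.
Qed.

Lemma hex_vertex_bij :
  exists2 phi : 'I_(N + N) -> hex_vertices k n, bijective phi &
    forall t, ((val (phi t)).1 : nat, (val (phi t)).2 : nat) = position (split t).
Proof.
have vertex_at t : exists v : hex_vertices k n,
    ((val v).1 : nat, (val v).2 : nat) = position (split t).
  have ij_vertex := position_vertex (split t).
  move: (position _) ij_vertex => [i j] /= ij_vertex.
  have lt_i : i < n + 2 by move: ij_vertex; rewrite /hex_vertex; lia.
  have lt_j : j < 2 * k + 3 by move: ij_vertex; rewrite /hex_vertex; lia.
  by exists (exist _ (Ordinal lt_i, Ordinal lt_j) ij_vertex).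
have [phi phiE] := fin_all_exists vertex_at.
exists phi => //; apply: inj_surj_bij => [s t eq_phi | v].
  apply: (can_inj (@splitK _ _)); apply: position_inj.
  by rewrite -!phiE eq_phi.
have [s posE] := position_surj _ _ (valP v); exists (unsplit s).
have := phiE (unsplit s); rewrite unsplitK posE => - [eq1 eq2].
apply: val_inj; rewrite [LHS]surjective_pairing [RHS]surjective_pairing.
by congr (_, _); apply: val_inj.
Qed.

End HexagonalCoordinates.

(** * The determinant of the hexagonal grid *)

Lemma hex_adjE (k n : nat) (u v : hex_vertices k n) :
  hex_adj u v =
  hex_arc k n (val u).1 (val u).2 (val v).1 (val v).2 ||
  hex_arc k n (val v).1 (val v).2 (val u).1 (val u).2.
Proof. by rewrite /hex_adj; case: (val u) (val v) => [i j] [i' j']. Qed.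

Lemma det_hex_adjacency (k n : nat) :
  let N := (k * n + n + k)%N in
  \det (adjacency_matrix (hex_grid k n)) =
  (-1) ^+ N * \det (\matrix_(a < N, b < N) (grid_step k.+1 a.+1 b)%:R) ^+ 2 :> int.
Proof.
move=> N; set B := (X in \det X ^+ 2).
have [phi phi_bij phiE] := hex_vertex_bij k n.
rewrite /adjacency_matrix (det_reindex _ _ _ _ (fun u v => (hex_adj u v)%:R) phi_bij).
(* By symmetry of adjacency the lower block is the transpose of the upper one. *)
rewrite expr2 -[X in _ * (_ * X)]det_tr -det_block_antidiag; congr (\det _).
have same_parity (u v : nat * nat) : odd u.2 = odd v.2 ->
    hex_arc k n u.1 u.2 v.1 v.2 || hex_arc k n v.1 v.2 u.1 u.2 = false.
  by move=> eq_odd; apply/norP; split; apply/negP => /hex_arc_parity; lia.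
apply/matrixP => s t; rewrite !mxE hex_adjE.
have [-> ->] : (val (phi s)).1 = (position k n (split s)).1 :> nat /\
  (val (phi s)).2 = (position k n (split s)).2 :> nat by rewrite -phiE.
have [-> ->] : (val (phi t)).1 = (position k n (split t)).1 :> nat /\
  (val (phi t)).2 = (position k n (split t)).2 :> nat by rewrite -phiE.
case: (split s) => x; rewrite !mxE; case: (split t) => y; rewrite !mxE.
- by rewrite same_parity // !odd_odd_position.
- by rewrite hex_arc_grid_step ?ltn_ord // ltnW.
- by rewrite orbC hex_arc_grid_step ?ltn_ord // ltnW.
- by rewrite same_parity // !(negPf (odd_even_position _ _)).
Qed.

Theorem theorem3 (k n : nat) (hk : (1 <= k)%N) (hn : (1 <= n)%N) :
  \det (adjacency_matrix (hex_grid k n)) =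
    (-1) ^+ (k * n + n + k) * ('C(n + k, n)%:R) ^+ 2 :> int.
Proof. by rewrite det_hex_adjacency (sqr_det_step_minor k n). Qed.
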